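(* Let $G$ and $H$ be finite simple connected graphs with $G$ triangle-free, and let $\times(G,H)$ be their tensor product. Then $$M^{ev}(\times(G,H)) = 4M_2(G)M_2(H) + F(G)F(H).$$
   Context: For a finite simple graph $K$: $V(K)$ and $E(K)$ are its vertex and edge sets, $d_K(x)$ is the degree of the vertex $x$, and $N[x]$ is the closed neighbourhood of $x$. For an edge $e=xy$ of $K$, the edge-vertex degree is $deg^{ev}_K(e)=|N[x]\cup N[y]|$; equivalently $deg^{ev}_K(e)=d_K(x)+d_K(y)-\eta_K(e)$, where $\eta_K(e)$ is the number of triangles of $K$ containing $e$. The $ev$-degree Zagreb index is $M^{ev}(K)=\sum_{e\in E(K)} deg^{ev}_K(e)^2$. The second Zagreb index is $M_2(K)=\sum_{xy\in E(K)} d_K(x)d_K(y)$ and the forgotten index is $F(K)=\sum_{x\in V(K)} d_K(x)^3$. The tensor (Kronecker) product $\times(G,H)$ has vertex set $V(G)\times V(H)$, and $(x,y)$ is adjacent to $(x',y')$ iff $xx'\in E(G)$ and $yy'\in E(H)$. *)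

(* Defs.v *)
From mathcomp Require Import all_boot.

Set Implicit Arguments.
Unset Strict Implicit.
Unset Printing Implicit Defensive.

Record sgraph := SGraph {
  vertex :> finType;
  adj : rel vertex;
  adj_sym : symmetric adj;
  adj_irrefl : irreflexive adj
}.

Section Invariants.
Variable K : sgraph.

(* Edges are unordered: two-element sets of adjacent vertices. *)
Definition edges : {set {set K}} :=
  [set [set p.1; p.2] | p in [set p : K * K | adj p.1 p.2]].

Definition nbhd (x : K) : {set K} := [set y | adj x y].
Definition closed_nbhd (x : K) : {set K} := x |: nbhd x.
Definition degree (x : K) : nat := #|nbhd x|.

(* On an edge e = [set x; y] this is #|N[x] :|: N[y]|; see ev_degree2. *)
Definition ev_degree (e : {set K}) : nat := #|\bigcup_(x in e) closed_nbhd x|.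

Definition ev_zagreb : nat := \sum_(e in edges) ev_degree e ^ 2.

(* On an edge e = [set x; y] the summand is d(x) d(y); see prod_degree2. *)
Definition zagreb2 : nat := \sum_(e in edges) \prod_(x in e) degree x.

Definition forgotten : nat := \sum_(x : K) degree x ^ 3.

(* The null graph is not considered connected. *)
Definition connected_graph : Prop :=
  0 < #|K| /\ forall x y : K, connect (@adj K) x y.

Definition triangle_free : Prop :=
  forall x y z : K, ~~ [&& adj x y, adj y z & adj x z].

Lemma edgesP (e : {set K}) :
  reflect (exists x y, adj x y /\ e = [set x; y]) (e \in edges).
Proof.
apply: (iffP imsetP) => [[[x y]]|[x [y [xy ->]]]].
  by rewrite inE /= => xy ->; exists x, y.
by exists (x, y); rewrite ?inE.
Qed.

Lemma adj_neq (x y : K) : adj x y -> x != y.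
Proof. by apply: contraTneq => ->; rewrite adj_irrefl. Qed.

Lemma ev_degree2 (x y : K) :
  ev_degree [set x; y] = #|closed_nbhd x :|: closed_nbhd y|.
Proof. by rewrite /ev_degree bigcup_setU !big_set1. Qed.

Lemma prod_degree2 (x y : K) :
  adj x y -> \prod_(z in [set x; y]) degree z = degree x * degree y.
Proof. by move=> xy; rewrite big_setU1 ?big_set1 // inE adj_neq. Qed.

End Invariants.

Section Tensor.
Variables G H : sgraph.

Definition tensor_adj (p q : G * H) : bool := adj p.1 q.1 && adj p.2 q.2.

Lemma tensor_adj_sym : symmetric tensor_adj.
Proof. by move=> p q; rewrite /tensor_adj adj_sym [adj p.2 _]adj_sym. Qed.

Lemma tensor_adj_irrefl : irreflexive tensor_adj.
Proof. by move=> p; rewrite /tensor_adj adj_irrefl. Qed.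

Definition tensor : sgraph :=
  @SGraph (G * H)%type tensor_adj tensor_adj_sym tensor_adj_irrefl.

End Tensor.

(* Main.v *)
Require Import Defs.
From mathcomp Require Import all_boot.
From mathcomp Require Import ring.

(** A triangle of the tensor product projects to a triangle of [G], so the
    product is triangle-free, and in a triangle-free graph the neighbourhoods
    of the two ends of an edge are disjoint: the ev-degree of an edge is the sum
    of the degrees of its ends.  As degrees multiply in the product, the edge
    joining [(x, y)] to [(x', y')] contributes
    [(d x * d y + d x' * d y') ^ 2].

    Expanding the square separates the two factors of the product, provided one
    sums over arcs, i.e. ordered pairs of adjacent vertices: the arcs of the
    product are exactly the pairs of an arc of [G] and an arc of [H]
    ([arc_sum_tensor]), whereas a pair of unordered edges gives two edges of the
    product.  Each edge carries two arcs ([arc_sum_edges]).  Over arcs, each of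
    the two squares sums to [F(G) F(H)], since a vertex [x] starts [d x] arcs
    ([arc_sum_degree_sq]), and the double product sums to
    [2 * (2 M_2(G)) * (2 M_2(H))].  Halving the total gives the formula. *)

Definition arc_sum (K : sgraph) (f : K -> K -> nat) : nat :=
  \sum_x \sum_(y | adj x y) f x y.

Lemma eq_arc_sum (K : sgraph) (f g : K -> K -> nat) :
  (forall x y, adj x y -> f x y = g x y) -> arc_sum K f = arc_sum K g.
Proof. by move=> fg; apply: eq_bigr => x _; apply: eq_bigr => y /fg. Qed.

Lemma arc_sumD (K : sgraph) (f g : K -> K -> nat) :
  arc_sum K (fun x y => f x y + g x y) = arc_sum K f + arc_sum K g.
Proof. by rewrite /arc_sum -big_split; apply: eq_bigr => x _; exact: big_split. Qed.

Lemma arc_sumMl (K : sgraph) (c : nat) (f : K -> K -> nat) :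
  arc_sum K (fun x y => c * f x y) = c * arc_sum K f.
Proof.
by rewrite /arc_sum big_distrr; apply: eq_bigr => x _; rewrite big_distrr.
Qed.

Lemma arc_sum_rev (K : sgraph) (f : K -> K -> nat) :
  arc_sum K (fun x y => f y x) = arc_sum K f.
Proof.
rewrite /arc_sum (exchange_big_dep predT) //=.
by apply: eq_bigr => x _; apply: eq_bigl => y; rewrite adj_sym.
Qed.

(** The fibre of [(x, y) |-> [set x; y]] over an edge consists of the two
    orientations of that edge, which differ because there are no loops. *)
Lemma arc_sum_edges (K : sgraph) (h : {set K} -> nat) :
  arc_sum K (fun x y => h [set x; y]) = 2 * \sum_(e in edges K) h e.
Proof.
rewrite /arc_sum pair_big_dep /=.
rewrite (partition_big (fun p : K * K => [set p.1; p.2]) (mem (edges K))) /=;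
  last by move=> [x y] /= xy; apply/edgesP; exists x, y.
rewrite big_distrr /=; apply: eq_bigr => e /edgesP [x [y [xy ->]]].
rewrite (eq_bigr (fun=> h [set x; y])); last by move=> p /andP [_ /eqP ->].
rewrite sum_nat_const; congr (_ * _).
have <- : #|[set (x, y); (y, x)]| = 2.
  by rewrite cards2 xpair_eqE negb_and (adj_neq xy).
apply: eq_card => -[u v]; rewrite !inE !xpair_eqE /=.
apply/andP/orP => [[uv /eqP uv_xy]|].
  have := adj_neq uv.
  have: u \in [set x; y] by rewrite -uv_xy set21.
  have: v \in [set x; y] by rewrite -uv_xy set22.
  rewrite !inE => /orP[] /eqP -> /orP[] /eqP ->; rewrite !eqxx //.
    by right.
  by left.
by case=> /andP[/eqP -> /eqP ->]; rewrite ?xy ?[adj y x]adj_sym ?xy // setUC.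
Qed.

Lemma arc_sum_degree_sq (K : sgraph) :
  arc_sum K (fun x _ => degree x ^ 2) = forgotten K.
Proof.
apply: eq_bigr => x _; rewrite sum_nat_const expnS; congr (_ * _).
by rewrite /degree cardsE.
Qed.

Lemma arc_sum_degree_mul (K : sgraph) :
  arc_sum K (fun x y => degree x * degree y) = 2 * zagreb2 K.
Proof.
by rewrite -arc_sum_edges; apply: eq_arc_sum => x y xy; rewrite prod_degree2.
Qed.

Lemma ev_degree_triangle_free (K : sgraph) (x y : K) :
  triangle_free K -> adj x y -> ev_degree [set x; y] = degree x + degree y.
Proof.
move=> Ktf xy; rewrite ev_degree2.
(* Each end of the edge is an open neighbour of the other. *)
have -> : closed_nbhd x :|: closed_nbhd y = nbhd x :|: nbhd y.
  apply/setP => z; rewrite !inE.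
  have [->|_] := eqVneq z x; first by rewrite [adj y x]adj_sym xy !orbT.
  by have [->|_] := eqVneq z y; rewrite ?xy.
rewrite cardsU; suff -> : nbhd x :&: nbhd y = set0 by rewrite cards0 subn0.
by apply/setP => z; rewrite !inE; apply/negP => /andP [xz yz];
  have := Ktf x y z; rewrite xy yz xz.
Qed.

Section Tensor.
Variables G H : sgraph.

Lemma tensor_triangle_free : triangle_free G -> triangle_free (tensor G H).
Proof.
move=> Gtf p q r; apply/negP => /and3P [/andP[pq _] /andP[qr _] /andP[pr _]].
by have := Gtf p.1 q.1 r.1; rewrite pq qr pr.
Qed.

Lemma degree_tensor (p : tensor G H) : degree p = degree p.1 * degree p.2.
Proof.
by rewrite /degree -cardsX; apply: eq_card => q; rewrite !inE.
Qed.

(** An arc of the product is by definition an arc of [G] paired with an arc of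
    [H], so this is the distributivity of the product of the two sums. *)
Lemma arc_sum_tensor (g : G -> G -> nat) (h : H -> H -> nat) :
  arc_sum (tensor G H) (fun p q => g p.1 q.1 * h p.2 q.2) =
  arc_sum G g * arc_sum H h.
Proof.
rewrite /arc_sum big_distrlr pair_bigA /=.
by apply: eq_bigr => p _; rewrite big_distrlr pair_big.
Qed.

End Tensor.

Theorem theorem3p6 (G H : sgraph)
    (Gconn : connected_graph G) (Hconn : connected_graph H)
    (Gtf : triangle_free G) :
  ev_zagreb (tensor G H) =
    4 * zagreb2 G * zagreb2 H + forgotten G * forgotten H.
Proof.
set T := tensor G H.
have square_sum :
    arc_sum T (fun p _ => degree p ^ 2) = forgotten G * forgotten H.
  rewrite -!arc_sum_degree_sq -arc_sum_tensor; apply: eq_arc_sum => p q _.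
  by rewrite degree_tensor expnMn.
have product_sum : arc_sum T (fun p q => degree p * degree q) =
    (2 * zagreb2 G) * (2 * zagreb2 H).
  rewrite -!arc_sum_degree_mul -arc_sum_tensor; apply: eq_arc_sum => p q _.
  by rewrite !degree_tensor mulnACA.
have twice : 2 * ev_zagreb T = 2 * (forgotten G * forgotten H)
    + 2 * ((2 * zagreb2 G) * (2 * zagreb2 H)).
  rewrite -arc_sum_edges -product_sum -arc_sumMl mul2n -addnn.
  (* Reversing the arcs turns one of the two copies of the sum of
     [degree p ^ 2] into the sum of [degree q ^ 2]. *)
  rewrite -[in X in X + _ + _]square_sum -[in X in _ + X + _]square_sum.
  rewrite -[X in _ + X + _]arc_sum_rev -!arc_sumD.
  apply: eq_arc_sum => p q pq.
  by rewrite ev_degree_triangle_free ?sqrnD //; apply: tensor_triangle_free.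
apply/eqP; rewrite -(eqn_pmul2l (isT : 0 < 2)) twice; apply/eqP; ring.
Qed.
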